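(* Let $q=r^2$, where $r$ is an odd prime power. Let $s,t$ be integers with $1\le s\le \frac{r+1}{2}$ and $1\le t\le \frac{r-1}{2}$, and let $n=s(r-1)+t(r+1)$. Then there exists a $q$-ary NMDS self-dual code of length $n$ if $r$ and $s$ satisfy one of the following: (1) $r\equiv 1\pmod 4$ and $s$ is even; (2) $r\equiv 3\pmod 4$ and $s$ is odd.
   Context: A $q$-ary $[n,k,d]$-linear code is a subspace $\mathcal C$ of $\mathbb F_q^n$ (with $\mathbb F_q$ the finite field of $q$ elements) of dimension $k$ and minimum (Hamming) distance $d$; $n$ is its length. Its dual is $\mathcal C^{\bot}=\{b\in\mathbb F_q^n : \sum_{i=1}^n a_ib_i=0 \text{ for all } a\in\mathcal C\}$; $\mathcal C$ is self-dual if $\mathcal C=\mathcal C^{\bot}$. An $[n,k,d]$-linear code is AMDS if $d=n-k$. An AMDS code $\mathcal C$ is NMDS if $\mathcal C^{\bot}$ is also AMDS. *)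

(* Defs.v *)
From mathcomp Require Import all_boot all_order all_algebra.

Set Implicit Arguments.
Unset Strict Implicit.
Unset Printing Implicit Defensive.

Import GRing.Theory.
Local Open Scope ring_scope.

Definition prime_power (r : nat) : Prop :=
  exists p m : nat, [/\ prime p, (0 < m)%N & r = (p ^ m)%N].

Definition hamming_dist (F : finFieldType) (n : nat) (a b : 'rV[F]_n) : nat :=
  #|[set i : 'I_n | a 0 i != b 0 i]|.

(* The zero code has no minimum distance: this predicate is then false for
   every [d]. *)
Definition has_min_dist (F : finFieldType) (n : nat)
    (C : {vspace 'rV[F]_n}) (d : nat) : Prop :=
  (exists a b, [/\ a \in C, b \in C, a != b & hamming_dist a b = d]) /\
  (forall a b, a \in C -> b \in C -> a != b -> (d <= hamming_dist a b)%N).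

Definition linear_code (F : finFieldType) (n k d : nat)
    (C : {vspace 'rV[F]_n}) : Prop :=
  \dim C = k /\ has_min_dist C d.

(* [mulmxr a^T] is the linear map [b |-> b *m a^T], whose only entry is the
   standard inner product of [a] and [b]; see [mem_dual_code]. *)
Definition dual_code (F : finFieldType) (n : nat)
    (C : {vspace 'rV[F]_n}) : {vspace 'rV[F]_n} :=
  (\bigcap_(a : 'rV[F]_n | a \in C) lker (linfun (mulmxr a^T : 'rV_n -> 'rV_1)))%VS.

Lemma mem_dual_code (F : finFieldType) (n : nat) (C : {vspace 'rV[F]_n})
    (b : 'rV[F]_n) :
  b \in dual_code C <-> (forall a, a \in C -> \sum_(i < n) a 0 i * b 0 i = 0).
Proof.
have ker a : (b \in lker (linfun (mulmxr a^T : 'rV_n -> 'rV_1))) =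
             (\sum_(i < n) a 0 i * b 0 i == 0).
  rewrite memv_ker lfunE /=.
  have -> : b *m a^T = (\sum_(i < n) a 0 i * b 0 i)%:M.
    apply/matrixP=> i j; rewrite !ord1 !mxE eqxx mulr1n.
    by apply: eq_bigr => k _; rewrite mxE mulrC.
  by rewrite -scalemx1 scaler_eq0 oner_eq0 orbF.
rewrite memvE; split=> [/subv_bigcapP bC a aC | bC].
  by apply/eqP; rewrite -ker memvE bC.
by apply/subv_bigcapP=> a aC; rewrite -memvE ker bC.
Qed.

Definition self_dual (F : finFieldType) (n : nat)
    (C : {vspace 'rV[F]_n}) : Prop :=
  C = dual_code C.

(* [d = n - k] without truncated subtraction. *)
Definition AMDS (F : finFieldType) (n : nat) (C : {vspace 'rV[F]_n}) : Prop :=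
  exists k d : nat, linear_code k d C /\ (d + k)%N = n.

Definition NMDS (F : finFieldType) (n : nat) (C : {vspace 'rV[F]_n}) : Prop :=
  AMDS C /\ AMDS (dual_code C).

(* Main.v *)
Require Import Defs.
From mathcomp Require Import all_boot all_order all_algebra.
From mathcomp Require Import all_field zify ring.

Set Implicit Arguments.
Unset Strict Implicit.
Unset Printing Implicit Defensive.

Import GRing.Theory.
Local Open Scope ring_scope.

(* The code consists of the words (v_x f(x))_(x in S), with f of degree at most
   N = n/2 and no term of degree N - 1. A nonzero f has at most N roots, so the
   minimum distance is at least N, and it equals N as soon as some N-subset of S
   has zero sum. By Lagrange interpolation the code is self-orthogonal when S has
   zero sum and v_x^2 * prod_(y <> x) (x - y) does not depend on x; such v exist
   when the quadratic character is constant on these products.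

   Write r = 2h + 1; the congruence condition says that s and h have the same
   parity. S is the union of the preimage of s nonsquares of the norm-one group
   under x^(r-1), and of the preimage of t nonzero squares of the subfield of size
   r under x^(r+1): s cosets of F_r^* and t cosets of the norm-one group. Since S
   is stable under negation, zero-sum subsets of any even size are unions of pairs
   {x, -x}; odd sizes need one odd zero-sum subset without such a pair. *)

(** * Vanishing polynomials of finite sets and Lagrange interpolation *)

Definition set_poly (F : finFieldType) (S : {set F}) : {poly F} :=
  \prod_(x in S) ('X - x%:P).

(** For [a] in [S] this is the derivative of [set_poly S] at [a], the denominator in Lagrange
    interpolation at the points of [S]. *)
Definition diff_prod (F : finFieldType) (S : {set F}) (a : F) : F :=
  \prod_(x in S | x != a) (a - x).

Lemma set_poly_enum (F : finFieldType) (S : {set F}) :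
  set_poly S = \prod_(x <- enum S) ('X - x%:P).
Proof. by rewrite /set_poly -big_enum. Qed.

Lemma size_set_poly (F : finFieldType) (S : {set F}) :
  size (set_poly S) = #|S|.+1.
Proof. by rewrite set_poly_enum size_prod_XsubC -cardE. Qed.

Lemma set_poly_monic (F : finFieldType) (S : {set F}) : set_poly S \is monic.
Proof. exact: monic_prod_XsubC. Qed.

Lemma root_set_poly (F : finFieldType) (S : {set F}) (x : F) :
  root (set_poly S) x = (x \in S).
Proof. by rewrite set_poly_enum root_prod_XsubC mem_enum. Qed.

Lemma horner_set_poly (F : finFieldType) (S : {set F}) (a : F) :
  (set_poly S).[a] = \prod_(x in S) (a - x).
Proof. by rewrite horner_prod; apply: eq_bigr => x _; rewrite !hornerE. Qed.

Lemma coef_set_poly_pred (F : finFieldType) (S : {set F}) :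
  (0 < #|S|)%N -> (set_poly S)`_#|S|.-1 = - \sum_(x in S) x.
Proof.
move=> S_gt0; rewrite set_poly_enum cardE coefPn_prod_XsubC -?cardE -?lt0n //.
by rewrite big_enum.
Qed.

Lemma coef_set_poly_card (F : finFieldType) (S : {set F}) :
  (set_poly S)`_#|S| = 1.
Proof.
by have /monicP := set_poly_monic S; rewrite lead_coefE size_set_poly.
Qed.

Lemma deriv_set_poly (F : finFieldType) (S : {set F}) (a : F) :
  a \in S -> (set_poly S)^`().[a] = diff_prod S a.
Proof.
move=> aS; rewrite /set_poly (bigD1 a) //= derivM hornerD !hornerM.
rewrite derivXsubC !hornerE subrr mul0r addr0 horner_prod.
by apply: eq_bigr => x _; rewrite !hornerE.
Qed.

Lemma diff_prod_neq0 (F : finFieldType) (S : {set F}) (a : F) :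
  diff_prod S a != 0.
Proof.
by apply/prodf_neq0 => x /andP[_ xa]; rewrite subr_eq0 eq_sym.
Qed.

Lemma diff_prodU (F : finFieldType) (A B : {set F}) (a : F) :
    [disjoint A & B] ->
  diff_prod (A :|: B) a = diff_prod A a * diff_prod B a.
Proof.
move=> dAB; rewrite /diff_prod (bigID (mem A)) /=; congr (_ * _).
  apply: eq_bigl => x; rewrite !inE.
  by case: (x \in A); rewrite /= ?andbF ?andbT.
apply: eq_bigl => x; rewrite !inE.
case xA: (x \in A); rewrite /= ?andbF ?andbT //.
by rewrite (disjointFr dAB xA).
Qed.

(* The interpolation polynomial of f at the points of S is f itself; compare
   the coefficients of degree #|S| - 1. *)
Lemma sum_lagrange (F : finFieldType) (S : {set F}) (f : {poly F}) :
    (size f < #|S|)%N ->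
  \sum_(x in S) f.[x] / diff_prod S x = 0.
Proof.
move=> szf.
pose L x := set_poly (S :\ x).
have szL x : x \in S -> size (L x) = #|S|.
  by move=> xS; rewrite size_set_poly (cardsD1 x S) xS.
have LE x : (L x).[x] = diff_prod S x.
  rewrite horner_set_poly; apply: eq_bigl => y.
  by rewrite !inE andbC.
pose g := \sum_(x in S) (f.[x] / diff_prod S x) *: L x.
have szg : (size g <= #|S|)%N.
  apply: (leq_trans (size_sum _ _ _)); apply/bigmax_leqP => x xS.
  by rewrite (leq_trans (size_scale_leq _ _)) // szL.
have gE y : y \in S -> g.[y] = f.[y].
  move=> yS; rewrite horner_sum (bigD1 y) //= hornerZ LE.
  rewrite divfK ?diff_prod_neq0 // big1 ?addr0 // => x /andP[xS xy].
  rewrite hornerZ; suff /rootP-> : root (L x) y by rewrite mulr0.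
  by rewrite root_set_poly !inE eq_sym xy.
have fg : f = g.
  apply/eqP; rewrite -subr_eq0; apply/negPn/negP => fg0.
  have : all (root (f - g)) (enum S).
    apply/allP => y; rewrite mem_enum => yS.
    by rewrite rootE hornerD hornerN gE // subrr.
  move=> /(max_poly_roots fg0)/(_ (enum_uniq _)); rewrite -cardE ltnNge.
  by rewrite (leq_trans (size_polyD _ _)) // size_polyN geq_max (ltnW szf) szg.
have : f`_#|S|.-1 = 0.
  by apply: nth_default; rewrite -ltnS prednK //; apply: leq_ltn_trans szf.
rewrite {1}fg coef_sum; apply: etrans; apply: eq_bigr => x xS.
have /monicP := set_poly_monic (S :\ x).
by rewrite coefZ lead_coefE -/(L x) szL // => ->; rewrite mulr1.
Qed.

(** * Fibres of power maps in a finite field *)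

Lemma exp_card_pred (F : finFieldType) (x : F) :
  x != 0 -> x ^+ #|F|.-1 = 1.
Proof.
move=> x0; apply: (mulfI x0); rewrite -exprS prednK ?mulr1 ?expf_card //.
by apply/card_gt0P; exists 0.
Qed.

Lemma factor_card_gt0 (F : finFieldType) (k m : nat) :
  (k * m)%N = #|F|.-1 -> (0 < k)%N.
Proof.
have : (1 < #|F|)%N by exact: finNzRing_gt1.
by case: k => //; rewrite mul0n; case: #|F| => [|[]].
Qed.

(* X^k - c divides X^(#|F| - 1) - 1, which is split with simple roots. *)
Lemma set_poly_powers (F : finFieldType) (k m : nat) (c : F) :
    (k * m)%N = #|F|.-1 -> c ^+ m = 1 ->
  set_poly [set x | x ^+ k == c] = 'X^k - c%:P.
Proof.
move=> km cm.
have F0 : (0 < #|F|)%N by apply/card_gt0P; exists 0.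
have k0 := factor_card_gt0 km.
have mon : 'X^k - c%:P \is monic by rewrite monicXnsubC.
have : 'X^k - c%:P %| \prod_(x <- index_enum F) ('X - x%:P).
  rewrite -finField_genPoly -(prednK F0) exprS.
  have -> : 'X * 'X^(#|F|.-1) - 'X
      = 'X * (('X^k) ^+ m - (c%:P) ^+ m) :> {poly F}.
    by rewrite -exprM km -polyC_exp cm mulrBr mulr1.
  by rewrite subrXX dvdp_mull // dvdp_mulr.
case/dvdp_prod_XsubC => b eqb.
have uq : uniq (mask b (index_enum F)) by rewrite mask_uniq ?index_enum_uniq.
have {}eqb : 'X^k - c%:P = \prod_(i <- mask b (index_enum F)) ('X - i%:P).
  by apply/eqP; rewrite -eqp_monic ?monic_prod_XsubC.
rewrite eqb /set_poly [RHS]big_uniq //=.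
apply: eq_bigl => x; rewrite inE -root_prod_XsubC -eqb rootE !hornerE.
by rewrite subr_eq0.
Qed.

Lemma card_powers (F : finFieldType) (k m : nat) (c : F) :
    (k * m)%N = #|F|.-1 -> c ^+ m = 1 -> #|[set x | x ^+ k == c]| = k.
Proof.
move=> km cm; apply: succn_inj.
rewrite -size_set_poly (set_poly_powers km cm) size_XnsubC //.
exact: factor_card_gt0 km.
Qed.

Lemma power_root (F : finFieldType) (k m : nat) (c : F) :
    (k * m)%N = #|F|.-1 -> c ^+ m = 1 -> exists x, x ^+ k = c.
Proof.
move=> km cm; have /card_gt0P[x] : (0 < #|[set x | x ^+ k == c]|)%N.
  by rewrite (card_powers km cm) (factor_card_gt0 km).
by rewrite inE => /eqP; exists x.
Qed.

(** By Vieta the sum is minus the coefficient of degree k - 1 in X^k - c, which vanishes once k >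
    1. *)
Lemma sum_powers (F : finFieldType) (k m : nat) (c : F) :
    (k * m)%N = #|F|.-1 -> c ^+ m = 1 -> (1 < k)%N ->
  \sum_(x in [set x | x ^+ k == c]) x = 0.
Proof.
move=> km cm k1; apply: oppr_inj; rewrite -coef_set_poly_pred.
  rewrite (card_powers km cm) (set_poly_powers km cm) oppr0.
  rewrite coefB coefXn coefC; case: k k1 {km} => [|[|k]] //= _.
  by rewrite ltn_eqF // subrr.
by rewrite (card_powers km cm) ltnW.
Qed.

(** * The evaluation code, its distances and its dual *)

(** [bump k] lists the exponents 0, ..., k + 1 without k, so these are the polynomials of degree at
    most N = k + 1 with no term of degree N - 1. *)
Definition msg_poly (F : finFieldType) (k : nat) (u : 'rV[F]_k.+1) : {poly F} :=
  \sum_j u 0 j *: 'X^(bump k j).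

Lemma size_msg_poly (F : finFieldType) (k : nat) (u : 'rV[F]_k.+1) :
  (size (msg_poly u) <= k.+2)%N.
Proof.
apply: (leq_trans (size_sum _ _ _)); apply/bigmax_leqP => j _.
rewrite (leq_trans (size_scale_leq _ _)) // size_polyXn.
by rewrite /bump; have := ltn_ord j; lia.
Qed.

Lemma coef_msg_poly (F : finFieldType) (k : nat) (u : 'rV[F]_k.+1)
    (j : 'I_k.+1) :
  (msg_poly u)`_(bump k j) = u 0 j.
Proof.
rewrite coef_sum (bigD1 j) //= coefZ coefXn eqxx mulr1 big1 ?addr0 // => i ij.
rewrite coefZ coefXn (inj_eq (can_inj (bumpK k))) eq_sym (inj_eq val_inj).
by rewrite (negPf ij) mulr0.
Qed.

Lemma msg_polyB (F : finFieldType) (k : nat) (u w : 'rV[F]_k.+1) :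
  msg_poly (u - w) = msg_poly u - msg_poly w.
Proof.
rewrite /msg_poly -sumrB; apply: eq_bigr => j _.
by rewrite !mxE scalerBl.
Qed.

Lemma msg_poly_eq0 (F : finFieldType) (k : nat) (u : 'rV[F]_k.+1) :
  (msg_poly u == 0) = (u == 0).
Proof.
apply/eqP/eqP => [u0|->].
  by apply/rowP => j; rewrite -coef_msg_poly u0 coef0 mxE.
by rewrite /msg_poly big1 // => j _; rewrite mxE scale0r.
Qed.

(** Used to turn [set_poly K], for a zero-sum [K], into a message. *)
Lemma msg_poly_coefs (F : finFieldType) (k : nat) (f : {poly F}) :
    (size f <= k.+2)%N -> f`_k = 0 ->
  msg_poly (\row_(j < k.+1) f`_(bump k j)) = f.
Proof.
move=> szf fk; apply/polyP => i.
have [ik|ik] := ltnP i k.+2; last first.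
  by rewrite !nth_default // ?(leq_trans szf) // (leq_trans (size_msg_poly _)).
have [->|ineq] := eqVneq i k.
  rewrite fk coef_sum big1 // => j _; rewrite coefZ coefXn.
  by rewrite (negPf (neq_bump _ _)) mulr0.
have ltu : (unbump k i < k.+1)%N by rewrite /unbump; lia.
have ei : i = bump k (Ordinal ltu) by rewrite /= unbumpKcond (negPf ineq).
by rewrite [in LHS]ei coef_msg_poly mxE -ei.
Qed.

Definition gen_mx (F : finFieldType) (k : nat) (S : {set F}) (v : F -> F) :
    'M[F]_(k.+1, #|S|) :=
  \matrix_(j, i) (v (enum_val i) * enum_val i ^+ bump k j).

Lemma mul_gen_mx (F : finFieldType) (k : nat) (S : {set F}) (v : F -> F)
    (u : 'rV[F]_k.+1) (i : 'I_#|S|) :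
  (u *m gen_mx k S v) 0 i = v (enum_val i) * (msg_poly u).[enum_val i].
Proof.
rewrite mxE horner_sum mulr_sumr; apply: eq_bigr => j _.
by rewrite mxE hornerZ hornerXn mulrCA.
Qed.

(** Since the multipliers do not vanish on [S], two codewords agree exactly at the roots in [S] of
    the difference of their polynomials. *)
Lemma hamming_dist_gen_mx (F : finFieldType) (k : nat) (S : {set F})
    (v : F -> F) (u w : 'rV[F]_k.+1) :
    (forall x, x \in S -> v x != 0) ->
  (hamming_dist (u *m gen_mx k S v) (w *m gen_mx k S v) +
     #|[set x in S | root (msg_poly (u - w)) x]|)%N = #|S|.
Proof.
move=> v0; rewrite /hamming_dist -sum1_card -[X in (_ + X)%N]sum1_card.
apply: etrans (sum1_card (mem S)).
rewrite [RHS]big_enum_val [RHS](bigID (fun i : 'I_#|S| =>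
   (u *m gen_mx k S v) 0 i != (w *m gen_mx k S v) 0 i)) /=; congr (_ + _)%N.
  by apply: eq_bigl => i; rewrite inE.
under eq_bigl => x do rewrite inE.
rewrite big_enum_val_cond; apply: eq_bigl => i /=.
rewrite negbK !mul_gen_mx (inj_eq (mulfI (v0 _ (enum_valP i)))).
by rewrite msg_polyB rootE !hornerE subr_eq0.
Qed.

Lemma card_roots_msg_poly (F : finFieldType) (k : nat) (S : {set F})
    (u : 'rV[F]_k.+1) :
  u != 0 -> (#|[set x in S | root (msg_poly u) x]| <= k.+1)%N.
Proof.
rewrite -msg_poly_eq0 => u0; rewrite -ltnS.
apply: leq_trans (size_msg_poly u); rewrite cardE.
apply: max_poly_roots => //; last exact: enum_uniq.
by apply/allP => x; rewrite mem_enum inE => /andP[].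
Qed.

(** A nonzero message killed by the matrix would give a nonzero polynomial vanishing on all of [S],
    more roots than its degree allows. *)
Lemma gen_mx_free (F : finFieldType) (k : nat) (S : {set F}) (v : F -> F) :
    (forall x, x \in S -> v x != 0) -> (k.+1 < #|S|)%N ->
  row_free (gen_mx k S v).
Proof.
move=> v0 kS; apply: inj_row_free => u uG; apply/eqP/negPn/negP => u0.
have := hamming_dist_gen_mx u 0 v0; rewrite uG mul0mx subr0.
have := card_roots_msg_poly S u0.
have -> : hamming_dist (0 : 'rV[F]_#|S|) 0 = 0%N.
  by apply: eq_card0 => i; rewrite inE eqxx.
lia.
Qed.

(* The products of two rows are the evaluations of X^e with e <= #|S| - 2 or
   e = #|S|; in the latter case X^e is reduced modulo set_poly S, which has no
   term of degree #|S| - 1. *)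
Lemma gen_mx_orthogonal (F : finFieldType) (k : nat) (S : {set F}) (v : F -> F)
    (l : F) :
    #|S| = k.+1.*2 -> \sum_(x in S) x = 0 ->
    (forall x, x \in S -> v x ^+ 2 * diff_prod S x = l) ->
  gen_mx k S v *m (gen_mx k S v)^T = 0.
Proof.
move=> cS S0 vl; apply/matrixP => j j'; rewrite !mxE.
set e := (bump k j + bump k j')%N.
(* Replacing [v x ^+ 2] by [l / diff_prod S x] turns the inner product into a Lagrange sum. *)
have -> : \sum_i gen_mx k S v j i * (gen_mx k S v)^T i j' =
    l * \sum_(x in S) ('X^e).[x] / diff_prod S x.
  rewrite [X in l * X]big_enum_val mulr_sumr; apply: eq_bigr => i _.
  rewrite !mxE hornerXn.
  rewrite -(vl _ (enum_valP i)) /e exprD.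
  have := diff_prod_neq0 S (enum_val i).
  by move: (diff_prod _ _) => d d0; field.
have [ltj ltj'] := (ltn_ord j, ltn_ord j').
have [lte|] := ltnP e k.*2.+1.
  by rewrite sum_lagrange ?mulr0 // size_polyXn cS doubleS ltnS.
(* Both exponents are at most k + 1 and differ from k, so a sum of at least 2k + 1 must be 2k +
   2. *)
move=> gee; have {gee ltj ltj'} ee : e = #|S|.
  by move: gee ltj ltj'; rewrite cS /e /bump; case: leqP; case: leqP; lia.
have -> : \sum_(x in S) ('X^e).[x] / diff_prod S x =
    \sum_(x in S) ('X^e - set_poly S).[x] / diff_prod S x.
  apply: eq_bigr => x xS; rewrite [in RHS]hornerD hornerN.
  by move: xS; rewrite -root_set_poly => /rootP ->; rewrite subr0.
rewrite sum_lagrange ?mulr0 // cS doubleS ltnS; apply/leq_sizeP => i.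
rewrite leq_eqVlt => /predU1P[<-|].
  have pS : (k.*2.+1 = #|S|.-1)%N by rewrite cS doubleS.
  rewrite coefB pS coef_set_poly_pred ?S0 ?cS // oppr0 subr0 coefXn ee cS.
  by rewrite doubleS ltn_eqF.
rewrite leq_eqVlt => /predU1P[<-|lti].
  have pS : (k.*2.+2 = #|S|)%N by rewrite cS doubleS.
  by rewrite coefB pS coef_set_poly_card coefXn ee eqxx subrr.
rewrite coefB coefXn ee cS doubleS gtn_eqF // sub0r nth_default ?oppr0 //.
by rewrite size_set_poly cS doubleS.
Qed.

(** The code lies in its dual by orthogonality and its dimension is half the length. Root counting
    bounds the distance below by k + 1, [K] supplies a word attaining it, and self-duality transfers
    AMDS to the dual. *)
Lemma nmds_self_dual_code (F : finFieldType) (k : nat) (S K : {set F})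
    (v : F -> F) (l : F) :
    #|S| = k.+1.*2 -> \sum_(x in S) x = 0 ->
    (forall x, x \in S -> v x != 0) ->
    (forall x, x \in S -> v x ^+ 2 * diff_prod S x = l) ->
    K \subset S -> #|K| = k.+1 -> \sum_(x in K) x = 0 ->
  exists C : {vspace 'rV[F]_#|S|}, NMDS C /\ self_dual C.
Proof.
move=> cS S0 v0 vl KS cK K0; set G := gen_mx k S v.
have GG : G *m G^T = 0 by exact: gen_mx_orthogonal vl.
have Gfree : row_free G by apply: gen_mx_free v0 _; rewrite cS; lia.
pose C := limg (linfun (mulmxr G : 'rV[F]_k.+1 -> 'rV[F]_#|S|)).
have memC c : reflect (exists u, c = u *m G) (c \in C).
  by apply: (iffP memv_imgP) => [[u _ ->]|[u ->]]; exists u;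
    rewrite ?memvf ?lfunE.
have sdC : self_dual C.
  apply/vspaceP => b; apply/idP/idP => [/memC[u ->]|/mem_dual_code dual].
    apply/mem_dual_code => a /memC[w ->]; have : (w *m G) *m (u *m G)^T = 0.
      by rewrite trmx_mul mulmxA -(mulmxA w) GG mulmx0 mul0mx.
    move/matrixP/(_ 0 0); rewrite mxE [RHS]mxE => wu; apply: etrans wu.
    by apply: eq_bigr => i _; congr (_ * _); rewrite [RHS]mxE.
  have bG : b *m G^T = 0.
    apply/rowP => j; rewrite mxE [RHS]mxE.
    have rC : row j G \in C by apply/memC; exists (delta_mx 0 j); rewrite -rowE.
    apply: etrans (dual _ rC); apply: eq_bigr => i _.
    by rewrite mulrC; congr (_ * _); rewrite !mxE.
  (* Orthogonality puts the row space of [G] inside the kernel of [G^T]; both have rank k + 1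
     because #|S| = 2(k + 1), so they coincide. *)
  apply/memC; suff /submxP : (b <= G)%MS by [].
  have [_] := mxrank_leqif_sup (introT sub_kermxP GG).
  have -> : \rank G == \rank (kermx G^T).
    by rewrite mxrank_ker mxrank_tr (eqnP Gfree) cS -addnn addnK.
  by move=> /esym; apply: submx_trans; apply/sub_kermxP.
suff amds : AMDS C by exists C; split=> //; split=> //; rewrite -sdC.
exists k.+1, k.+1; split; last by rewrite addnn -cS.
split.
  rewrite limg_dim_eq; first by rewrite dimvf /dim /= mul1n.
  apply/eqP; rewrite -subv0; apply/subvP => u; rewrite memv_cap memvf /=.
  rewrite memv_ker lfunE /= memv0 => uG; apply/eqP.
  by apply: (row_free_inj Gfree); rewrite (eqP uG) mul0mx.
split.
  (* The codeword of [set_poly K] vanishes exactly on the k + 1 points of [K]; its term of degree k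
     is absent because [K] has zero sum. *)
  pose u := \row_(j < k.+1) (set_poly K)`_(bump k j).
  have pu : msg_poly u = set_poly K.
    apply: msg_poly_coefs; first by rewrite size_set_poly cK.
    by rewrite -[k in _`_k]/k.+1.-1 -cK coef_set_poly_pred ?cK // K0 oppr0.
  have u0 : u != 0.
    by rewrite -msg_poly_eq0 pu monic_neq0 // set_poly_monic.
  exists (u *m G), 0; split; [by apply/memC; exists u | exact: mem0v | |].
    apply: contraNneq u0 => uG; apply/eqP.
    by apply: (row_free_inj Gfree); rewrite uG mul0mx.
  have := hamming_dist_gen_mx u 0 v0; rewrite mul0mx subr0 pu.
  have -> : [set x in S | root (set_poly K) x] = K.
    apply/setP => x; rewrite inE root_set_poly andb_idl //.
    by move/(subsetP KS).
  by rewrite cK => h; apply: (@addIn k.+1); rewrite h addnn.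
move=> a b /memC[u ->] /memC[w ->] uw.
have uw0 : u - w != 0 by rewrite subr_eq0; apply: contraNneq uw => ->.
rewrite -(leq_add2r k.+1) addnn.
rewrite -(etrans (hamming_dist_gen_mx u w v0) cS) leq_add2l.
exact: card_roots_msg_poly.
Qed.

(** * Zero-sum subsets of sets stable under negation *)

Lemma sum_symmetric (F : finFieldType) (S : {set F}) :
    2%:R != 0 :> F -> (forall x, x \in S -> - x \in S) ->
  \sum_(x in S) x = 0.
Proof.
move=> two0 symS; apply: (mulfI two0); rewrite mulr0 mulr2n mulrDl mul1r.
rewrite {1}(reindex_inj oppr_inj) /=.
have symE x : (- x \in S) = (x \in S).
  by apply/idP/idP => /symS; rewrite ?opprK.
by under eq_bigl => x do rewrite symE; rewrite sumrN addNr.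
Qed.

Lemma oppr_neq (F : fieldType) (x : F) : 2%:R != 0 :> F -> x != 0 -> x != - x.
Proof.
by move=> two0 x0; rewrite -subr_eq0 opprK -mulr2n -mulr_natl mulf_neq0.
Qed.

(** Induction adding one pair {x, -x} at a time; its two elements differ because x is nonzero and 2
    is invertible. *)
Lemma symmetric_subset (F : finFieldType) (S : {set F}) (j : nat) :
    2%:R != 0 :> F -> 0 \notin S -> (forall x, x \in S -> - x \in S) ->
    (j.*2 <= #|S|)%N ->
  exists W : {set F}, [/\ W \subset S, (forall x, x \in W -> - x \in W)
                        & #|W| = j.*2].
Proof.
move=> two0 S0 symS; elim: j => [_|j IHj jS].
  exists set0; split; [exact: sub0set | | exact: cards0].
  by move=> x; rewrite inE.
have /IHj[W [WS symW cW]] : (j.*2 <= #|S|)%N by rewrite doubleS in jS; lia.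
have /subsetPn[x xS xW] : ~~ (S \subset W).
  by apply: contraL jS => /subset_leq_card; rewrite cW doubleS; lia.
have x0 : x != 0 by apply: contraNneq S0 => <-.
exists (x |: (- x |: W)); split.
- by apply/subsetP => y; rewrite !inE => /or3P[/eqP->|/eqP->|/(subsetP WS)] //;
    exact: symS.
- move=> y; rewrite !inE => /or3P[/eqP->|/eqP->|/symW->].
  + by rewrite eqxx orbT.
  + by rewrite opprK eqxx.
  by rewrite !orbT.
rewrite !cardsU1 !inE cW (negPf xW) (negPf (oppr_neq two0 x0)) /=.
case: (boolP (- x \in W)) => [/symW|_]; first by rewrite opprK (negPf xW).
by rewrite doubleS.
Qed.

(** [K] consists of [T] and of pairs {x, -x} taken outside [T] and its negative. These two sets are
    disjoint, so #|T| <= k; as k - #|T| is even and 2(k - #|T|) points remain, there are enough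
    pairs. *)
Lemma zero_sum_half (F : finFieldType) (S T : {set F}) (k : nat) :
    2%:R != 0 :> F -> 0 \notin S -> (forall x, x \in S -> - x \in S) ->
    #|S| = k.*2 -> T \subset S -> (forall x, x \in T -> - x \notin T) ->
    \sum_(x in T) x = 0 -> odd #|T| = odd k ->
  exists K : {set F}, [/\ K \subset S, #|K| = k & \sum_(x in K) x = 0].
Proof.
move=> two0 S0 symS cS TS antiT T0 oddT.
pose T' : {set F} := [set - x | x in T].
have cT' : #|T'| = #|T| by rewrite card_imset //; exact: oppr_inj.
have memT' x : (x \in T') = (- x \in T).
  by rewrite -{1}(opprK x) mem_imset //; exact: oppr_inj.
have dT : [disjoint T & T'].
  by apply/pred0P => x /=; rewrite memT'; apply/negP => /andP[/antiT/negP].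
have cU : #|T :|: T'| = #|T|.*2.
  by rewrite cardsU (disjoint_setI0 dT) cards0 subn0 cT' addnn.
have US : T :|: T' \subset S.
  rewrite subUset TS; apply/subsetP => x; rewrite memT' => /(subsetP TS)/symS.
  by rewrite opprK.
have Tk : (#|T| <= k)%N by rewrite -leq_double -cU -cS subset_leq_card.
have cD : #|S :\: (T :|: T')| = (k - #|T|).*2.
  by rewrite cardsD (setIidPr US) cS cU doubleB.
have ek : ((k - #|T|)./2.*2 = k - #|T|)%N.
  by rewrite even_halfK // oddB // oddT addbb.
have [] := @symmetric_subset F (S :\: (T :|: T')) (k - #|T|)./2 two0.
- by rewrite inE (negPf S0) andbF.
- move=> x; rewrite !inE !memT' opprK => /andP[nx /symS->].
  by rewrite orbC nx.
- by rewrite ek cD -addnn leq_addr.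
move=> W [WS symW cW]; exists (T :|: W).
have dTW : [disjoint T & W].
  apply/pred0P => x /=; apply/negP => /andP[xT /(subsetP WS)].
  by rewrite !inE xT.
split.
- by rewrite subUset TS (subset_trans WS) // subsetDl.
- by rewrite cardsU (disjoint_setI0 dTW) cards0 subn0 cW ek subnKC.
rewrite (eq_bigl [predU T & W]) => [|x]; last by rewrite !inE.
by rewrite bigU //= T0 sum_symmetric // addr0.
Qed.

Lemma subset_of_card (T : finType) (A : {set T}) (s : nat) :
  (s <= #|A|)%N -> exists2 B : {set T}, B \subset A & #|B| = s.
Proof.
move=> sA.
have /card_gt0P[B] : (0 < #|[set B : {set T} | B \subset A & #|B| == s]|)%N.
  by rewrite cards_draws bin_gt0.
by rewrite inE => /andP[BA /eqP]; exists B.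
Qed.

(** * Preimages of sets under power maps *)

(** Grouping the factors by the value c of [x ^+ k], each fibre contributes X^k - c. *)
Lemma set_poly_preim (F : finFieldType) (k m : nat) (C : {set F}) :
    (k * m)%N = #|F|.-1 -> (forall c, c \in C -> c ^+ m = 1) ->
  set_poly [set x | x ^+ k \in C] = set_poly C \Po 'X^k.
Proof.
move=> km Cm; rewrite [X in X \Po _]/set_poly rmorph_prod /=.
rewrite {1}/set_poly (partition_big (fun x => x ^+ k) (mem C)) /=; last first.
  by move=> x; rewrite inE.
apply: eq_bigr => c cC.
rewrite comp_polyB comp_polyX comp_polyC -(set_poly_powers km (Cm c cC)).
apply: eq_bigl => x; rewrite !inE andb_idl //.
by move/eqP->.
Qed.

Lemma card_preim_exp (F : finFieldType) (k m : nat) (C : {set F}) :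
    (k * m)%N = #|F|.-1 -> (forall c, c \in C -> c ^+ m = 1) ->
  #|[set x | x ^+ k \in C]| = (#|C| * k)%N.
Proof.
move=> km Cm; apply: succn_inj; rewrite -size_set_poly (set_poly_preim km Cm).
have := size_comp_poly (set_poly C) 'X^k; rewrite size_set_poly size_polyXn /=.
move<-; rewrite prednK // lt0n size_poly_eq0 -(set_poly_preim km Cm).
exact/monic_neq0/set_poly_monic.
Qed.

(** Chain rule for [set_poly C] composed with X^k. *)
Lemma diff_prod_preim (F : finFieldType) (k m : nat) (C : {set F}) (a : F) :
    (k * m)%N = #|F|.-1 -> (forall c, c \in C -> c ^+ m = 1) ->
    a ^+ k \in C ->
  diff_prod [set x | x ^+ k \in C] a = k%:R * a ^+ k.-1 * diff_prod C (a ^+ k).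
Proof.
move=> km Cm aC; rewrite -deriv_set_poly ?inE // (set_poly_preim km Cm).
rewrite deriv_comp derivXn hornerM horner_comp hornerXn deriv_set_poly //.
by rewrite hornerMn hornerXn mulrC mulr_natl.
Qed.

(** Outside the preimage no factor is omitted, so this is a plain evaluation of the composed
    polynomial. *)
Lemma diff_prod_preim_notin (F : finFieldType) (k m : nat) (C : {set F})
    (a : F) :
    (k * m)%N = #|F|.-1 -> (forall c, c \in C -> c ^+ m = 1) ->
    a ^+ k \notin C ->
  diff_prod [set x | x ^+ k \in C] a = \prod_(c in C) (a ^+ k - c).
Proof.
move=> km Cm aC; rewrite -horner_set_poly -[X in _.[X]](hornerXn a k).
rewrite -horner_comp -(set_poly_preim km Cm) horner_set_poly.
apply: eq_bigl => x; rewrite andb_idr // inE => xC.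
by apply: contraNneq aC => <-.
Qed.

(** * Frobenius, the norm-one group, the subfield and the quadratic character *)

Lemma frobenius_sub (F : finFieldType) (p m : nat) (x y : F) :
    prime p -> #|F| = ((p ^ m) ^ 2)%N ->
  (x - y) ^+ (p ^ m) = x ^+ (p ^ m) - y ^+ (p ^ m).
Proof.
move=> p_pr; rewrite -expnM => /card_finPcharP/(_ p_pr) pcharF.
apply/eqP; rewrite eq_sym subr_eq -exprDn_pchar ?subrK //.
by rewrite pnatX (pnatE _ p_pr) pcharF.
Qed.

Lemma natr_root_card (F : finFieldType) (p m : nat) :
  prime p -> (0 < m)%N -> #|F| = ((p ^ m) ^ 2)%N -> (p ^ m)%:R = 0 :> F.
Proof.
move=> p_pr m0; rewrite -expnM => /card_finPcharP/(_ p_pr) pcharF.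
by rewrite natrX (pcharf0 pcharF) expr0n gtn_eqF.
Qed.

(** With r = 2h + 1, [h.*2] is r - 1 and [h.+1.*2] is r + 1. *)
Lemma card_pred_sqr (F : finFieldType) (h : nat) :
  #|F| = (h.*2.+1 ^ 2)%N -> (h.*2 * h.+1.*2)%N = #|F|.-1.
Proof. by move->; lia. Qed.

(** Raising to the power r inverts norm-one elements, so (c - d)^r = 1/c - 1/d = - (c - d)/(c d). *)
Lemma norm1_sub (F : finFieldType) (h : nat) (c d : F) :
    (forall x y : F, (x - y) ^+ h.*2.+1 = x ^+ h.*2.+1 - y ^+ h.*2.+1) ->
    c ^+ h.+1.*2 = 1 -> d ^+ h.+1.*2 = 1 -> c != d ->
  (c - d) ^+ h.*2 * (c * d) = -1.
Proof.
move=> frob; rewrite doubleS !(exprS _ _.+1) => cr dr; rewrite -subr_eq0 => cd.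
apply: (mulfI cd); rewrite [LHS]mulrA -exprS frob.
transitivity (c * c ^+ h.*2.+1 * d - c * (d * d ^+ h.*2.+1)); first by ring.
by rewrite cr dr; ring.
Qed.

(** Both elements are fixed by Frobenius, hence so is their nonzero difference. *)
Lemma subfield_sub (F : finFieldType) (h : nat) (c d : F) :
    (forall x y : F, (x - y) ^+ h.*2.+1 = x ^+ h.*2.+1 - y ^+ h.*2.+1) ->
    c ^+ h.*2 = 1 -> d ^+ h.*2 = 1 -> c != d ->
  (c - d) ^+ h.*2 = 1.
Proof.
move=> frob cr dr; rewrite -subr_eq0 => cd.
by apply: (mulfI cd); rewrite -exprS frob !exprS cr dr !mulr1.
Qed.

(* x ^+ (h.*2 * h.+1) is the quadratic character of the field of size
   (2h + 1)^2. *)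
Lemma quad_char_norm1_sub (F : finFieldType) (h : nat) (c d : F) :
    (forall x y : F, (x - y) ^+ h.*2.+1 = x ^+ h.*2.+1 - y ^+ h.*2.+1) ->
    c ^+ h.+1.*2 = 1 -> d ^+ h.+1 = -1 -> c != d ->
  (c - d) ^+ (h.*2 * h.+1) = c ^+ h.+1 * (-1) ^+ h.
Proof.
move=> frob cr dr cd.
have dr2 : d ^+ h.+1.*2 = 1 by rewrite -muln2 exprM dr sqrrN expr1n.
have := congr1 (fun x => x ^+ h.+1 * c ^+ h.+1) (norm1_sub frob cr dr2 cd).
have cc : c ^+ h.+1 * c ^+ h.+1 = 1 by rewrite -exprD addnn.
rewrite !exprMn -exprM dr mulrN1 mulrN mulNr -mulrA cc mulr1 => /eqP.
by rewrite eqr_oppLR => /eqP ->; rewrite exprS; ring.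
Qed.

Lemma prod_exp (R : comNzRingType) (I : finType) (P : pred I) (E : I -> R)
    (N : nat) (a : R) :
    (forall i, P i -> E i ^+ N = a) ->
  (\prod_(i | P i) E i) ^+ N = a ^+ #|P|.
Proof.
move=> Ea; rewrite -prodrXl (eq_bigr (fun=> a)) //.
by rewrite prodr_const.
Qed.

(** The character is -1 on the first preimage and 1 on the second. Factors coming from [D] lie in
    the subfield and contribute 1; those coming from [C] contribute the signs of
    [quad_char_norm1_sub]. The parity of #|C| makes the total the same on both preimages. *)
Lemma quad_char_diff_prod (F : finFieldType) (h : nat) (C D : {set F})
    (x : F) :
    (0 < h)%N -> #|F| = (h.*2.+1 ^ 2)%N -> h.*2.+1%:R = 0 :> F ->
    (forall x y : F, (x - y) ^+ h.*2.+1 = x ^+ h.*2.+1 - y ^+ h.*2.+1) ->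
    (forall c, c \in C -> c ^+ h.+1 = -1) ->
    (forall d, d \in D -> d ^+ h = 1) ->
    odd #|C| = odd h ->
    x \in [set x | x ^+ h.*2 \in C] :|: [set x | x ^+ h.+1.*2 \in D] ->
  diff_prod ([set x | x ^+ h.*2 \in C] :|: [set x | x ^+ h.+1.*2 \in D]) x
    ^+ (h.*2 * h.+1) = (-1) ^+ h.
Proof.
move=> h0 cardF r0 frob hC hD oddC.
have kmA := card_pred_sqr cardF.
have kmB : (h.+1.*2 * h.*2)%N = #|F|.-1 by rewrite mulnC.
have C1 c : c \in C -> c ^+ h.+1.*2 = 1.
  by move/hC => cr; rewrite -muln2 exprM cr sqrrN expr1n.
have D1 d : d \in D -> d ^+ h.*2 = 1.
  by move/hD => dr; rewrite -muln2 exprM dr expr1n.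
have charA y : y ^+ h.*2 \in C -> y ^+ (h.*2 * h.+1) = -1.
  by move/hC; rewrite -exprM.
have charB y : y ^+ h.+1.*2 \in D -> y ^+ (h.*2 * h.+1) = 1.
  by move/hD; rewrite -exprM => <-; congr (_ ^+ _); lia.
(* Nonzero elements of the subfield of size r are squares in [F]. *)
have charF y : y ^+ h.*2 = 1 -> y ^+ (h.*2 * h.+1) = 1.
  by rewrite exprM => ->; rewrite expr1n.
have two0 : 2%:R != 0 :> F.
  apply: contra_eq_neq r0 => two0; rewrite -addn1 natrD -mul2n natrM two0.
  by rewrite mul0r add0r oner_neq0.
have dAB : [disjoint [set x | x ^+ h.*2 \in C] & [set x | x ^+ h.+1.*2 \in D]].
  apply/pred0P => y; rewrite /= !inE; apply/negP => /andP[/charA yA /charB].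
  by move/eqP; rewrite yA eq_sym (negPf (oppr_neq two0 (oner_neq0 _))).
have char_nz (y : F) : y ^+ (h.*2 * h.+1) != 0 -> y ^+ #|F|.-1 = 1.
  move=> y0; apply: exp_card_pred; apply: contraNneq y0 => ->.
  by rewrite expr0n muln_eq0 double_eq0 (gtn_eqF h0).
rewrite inE diff_prodU // exprMn => /orP[]; rewrite inE => xS.
  have xD : x ^+ h.+1.*2 \notin D.
    apply/negP => xD; have := disjointFr dAB (x := x).
    by rewrite !inE xS xD => /(_ isT).
  have xN := charA _ xS.
  rewrite (diff_prod_preim kmA C1) // (diff_prod_preim_notin kmB D1) //.
  have PD : (\prod_(d in D) (x ^+ h.+1.*2 - d)) ^+ (h.*2 * h.+1) = 1.
    rewrite (prod_exp (a := 1)) ?expr1n // => d dD.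
    apply/charF/(subfield_sub frob); [|exact: D1|].
      by rewrite -exprM kmB char_nz // xN oppr_eq0 oner_eq0.
    by apply: contraNneq xD => ->.
  have PC : diff_prod C (x ^+ h.*2) ^+ (h.*2 * h.+1) = (-1) ^+ (h.+1 * #|C|.-1).
    rewrite [RHS]exprM /diff_prod (prod_exp (a := (-1) ^+ h.+1)).
      congr (_ ^+ _); rewrite (cardsD1 (x ^+ h.*2) C) xS /=.
      by apply: eq_card => c; rewrite !inE andbC.
    move=> c /andP[cC]; rewrite eq_sym => cx.
    rewrite (quad_char_norm1_sub frob (C1 _ xS) (hC _ cC)) //.
    by rewrite (hC _ xS) -exprS.
  have r1 : h.*2%:R = -1 :> F.
    by apply/eqP; rewrite -addr_eq0 -mulrSr r0.
  have xE : (x ^+ h.*2.-1) ^+ (h.*2 * h.+1) = (-1) ^+ h.*2.-1.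
    by rewrite exprAC xN.
  rewrite !exprMn PD PC mulr1 r1 xE -!exprD.
  (* Modulo 2 the exponent is 0 from r - 1 = -1, plus 1 from the power of x, plus (h + 1)(#|C| - 1),
     which has the parity of h + 1. *)
  rewrite -[LHS]signr_odd -[RHS]signr_odd; congr (_ ^+ _).
  have C0 : (0 < #|C|)%N by apply/card_gt0P; exists (x ^+ h.*2).
  have : odd #|C| = ~~ odd #|C|.-1 by rewrite -(prednK C0).
  have : odd h.*2.-1 = true by rewrite -(prednK h0) doubleS /= odd_double.
  rewrite oddC !oddD !oddM /= odd_double => -> ->.
  by case: (odd _).
have xC : x ^+ h.*2 \notin C.
  apply/negP => xC; have := disjointFr dAB (x := x).
  by rewrite !inE xS xC => /(_ isT).
have xN := charB _ xS.
rewrite (diff_prod_preim kmB D1) // (diff_prod_preim_notin kmA C1) //.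
have PD : diff_prod D (x ^+ h.+1.*2) ^+ (h.*2 * h.+1) = 1.
  rewrite /diff_prod (prod_exp (a := 1)) ?expr1n // => d /andP[dD dx].
  apply/charF/(subfield_sub frob); [exact: D1|exact: D1|].
  by rewrite eq_sym.
have PC : (\prod_(c in C) (x ^+ h.*2 - c)) ^+ (h.*2 * h.+1)
    = (-1) ^+ (h * #|C|).
  rewrite [RHS]exprM (prod_exp (a := (-1) ^+ h)) // => c cC.
  have x1 : (x ^+ h.*2) ^+ h.+1.*2 = 1.
    by rewrite -exprM kmA char_nz // xN oner_eq0.
  rewrite (quad_char_norm1_sub frob x1 (hC _ cC)).
    by rewrite -exprM xN mul1r.
  by apply: contraNneq xC => ->.
have r1 : h.+1.*2%:R = 1 :> F by rewrite doubleS -addn1 natrD r0 add0r.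
have xE : (x ^+ h.+1.*2.-1) ^+ (h.*2 * h.+1) = 1.
  by rewrite exprAC xN expr1n.
rewrite !exprMn PD PC r1 xE expr1n !mul1r ?mulr1.
by rewrite -[LHS]signr_odd -[RHS]signr_odd oddM oddC andbb.
Qed.

(** * An odd zero-sum subset without opposite pairs *)

Lemma powers_opp_notin (F : finFieldType) (k : nat) (c x : F) :
    2%:R != 0 :> F -> odd k -> c != 0 ->
  x \in [set x | x ^+ k == c] -> - x \notin [set x | x ^+ k == c].
Proof.
move=> two0 oddk c0; rewrite !inE => /eqP xc.
by rewrite exprNn -signr_odd oddk mulN1r xc eq_sym oppr_neq.
Qed.

(** [T] is a fibre of an odd power map: of x^(h+1), inside a fibre of x^(2h+2), if h is even; of
    x^h, inside a fibre of x^(2h), if h is odd. Oddness excludes pairs {x, -x} and [sum_powers]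
    gives the zero sum, except for h = 1, where such a fibre is a single nonzero point. *)
Lemma odd_zero_sum_subset (F : finFieldType) (h : nat) (C D : {set F}) :
    (0 < h)%N -> #|F| = (h.*2.+1 ^ 2)%N -> h.*2.+1%:R = 0 :> F ->
    2%:R != 0 :> F ->
    (forall c, c \in C -> c ^+ h.+1 = -1) ->
    (forall d, d \in D -> d ^+ h = 1) ->
    odd #|C| = odd h -> (0 < #|D|)%N ->
  exists T : {set F},
    [/\ T \subset [set x | x ^+ h.*2 \in C] :|: [set x | x ^+ h.+1.*2 \in D],
        (forall x, x \in T -> - x \notin T),
        \sum_(x in T) x = 0 & odd #|T|].
Proof.
move=> h0 cardF r0 two0 hC hD oddC /card_gt0P[d dD].
have kmA := card_pred_sqr cardF.
have kmB : (h.+1.*2 * h.*2)%N = #|F|.-1 by rewrite mulnC.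
have power_neq0 (x : F) m : (0 < m)%N -> x ^+ m = 1 -> x != 0.
  move=> m0; apply: contra_eq_neq => ->.
  by rewrite expr0n gtn_eqF // eq_sym oner_neq0.
case: (boolP (odd h)) oddC => [oddh|evenh] oddC; last first.
  have [b bd] : exists b, b ^+ h.+1.*2 = d.
    by apply: (power_root kmB); rewrite -muln2 exprM hD // expr1n.
  have km : (h.+1 * h.*2.*2)%N = #|F|.-1.
    by rewrite -kmB -doubleMr doubleMl.
  have b1 : (b ^+ h.+1) ^+ h.*2.*2 = 1.
    rewrite -exprM (_ : h.+1 * _ = h.+1.*2 * h * 2)%N; last by lia.
    by rewrite !exprM bd hD // expr1n.
  exists [set x | x ^+ h.+1 == b ^+ h.+1]; split.
  - apply/subsetP => x; rewrite !inE => /eqP xb; apply/orP; right.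
    by rewrite -muln2 exprM xb -exprM muln2 bd.
  - move=> x; apply: powers_opp_notin => //.
    by apply: power_neq0 b1; rewrite !double_gt0.
  - exact: sum_powers km b1 _.
  by rewrite (card_powers km b1).
have /card_gt0P[c cC] : (0 < #|C|)%N by case: #|C| oddC.
have [a ac] : exists a, a ^+ h.*2 = c.
  by apply: (power_root kmA); rewrite -muln2 exprM hC // sqrrN expr1n.
have [h1|h1] := ltnP 1 h.
  have km : (h * h.+1.*2.*2)%N = #|F|.-1.
    by rewrite -kmA -doubleMr doubleMl.
  have a1 : (a ^+ h) ^+ h.+1.*2.*2 = 1.
    rewrite -exprM (_ : h * _ = h.*2 * h.+1 * 2)%N; last by lia.
    by rewrite !exprM ac hC // sqrrN expr1n.
  exists [set x | x ^+ h == a ^+ h]; split.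
  - apply/subsetP => x; rewrite !inE => /eqP xa; apply/orP; left.
    by rewrite -muln2 exprM xa -exprM muln2 ac.
  - move=> x; apply: powers_opp_notin => //.
    by apply: power_neq0 a1; rewrite !double_gt0.
  - exact: sum_powers km a1 _.
  by rewrite (card_powers km a1).
(* The field has 9 elements: {a, e, - e a^2} with a^4 = -1 and e = 1 or -1. *)
have {h0} hE : h = 1%N by lia.
subst h.
have d1 : d = 1 by have := hD d dD; rewrite expr1.
subst d.
have a4 : a ^+ 4 = -1 by rewrite -(hC _ cC) -ac -exprM.
have three : 3%:R = 0 :> F by [].
(* In characteristic 3, a^4 = -1 gives (1 - a^2)^2 = -2 a^2 = a^2. Hence a is 1 - a^2 or its
   opposite, and e is -1 or 1 accordingly. *)
have sqr_a : a ^+ 2 = (1 - a ^+ 2) ^+ 2.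
  transitivity (1 - 2%:R * a ^+ 2 + a ^+ 4); last by ring.
  rewrite a4; transitivity (a ^+ 2 - 3%:R * a ^+ 2); last by ring.
  by rewrite three mul0r subr0.
have [e e2 sum_e] : exists2 e : F, e ^+ 2 = 1 & a + e - e * a ^+ 2 = 0.
  move/eqP: sqr_a; rewrite eqf_sqr => /orP[] /eqP aE.
    exists (-1); first by rewrite sqrrN expr1n.
    by rewrite {1}aE; ring.
  by exists 1; [rewrite expr1n | rewrite {1}aE; ring].
(* The squares of the three elements are a^2, 1 and -1; their being distinct excludes both equal and
   opposite elements. *)
have sqr_neq (x y : F) : x ^+ 2 != y ^+ 2 -> (x != y) && (x != - y).
  by rewrite eqf_sqr negb_or.
have a0 : a != 0.
  by apply: contra_eq_neq a4 => ->; rewrite expr0n eq_sym oppr_eq0 oner_neq0.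
have e0 : e != 0 by apply: power_neq0 e2.
have m1 : 1 != -1 :> F by rewrite oppr_neq // oner_neq0.
have a2 : (a ^+ 2 != 1) && (a ^+ 2 != -1).
  apply/andP; split; apply: contra_eq_neq a4 => a2.
    by rewrite -[4%N]/(2 * 2)%N exprM a2 expr1n.
  by rewrite -[4%N]/(2 * 2)%N exprM a2 sqrrN expr1n.
case/andP: a2 => a21 a2m.
have [w wE] : exists w, w = - (e * a ^+ 2) by eexists.
have w2 : w ^+ 2 = -1 by rewrite wE sqrrN exprMn e2 mul1r -exprM.
have w0 : w != 0.
  by rewrite wE oppr_eq0 mulf_neq0 // expf_neq0.
have /sqr_neq/andP[ae aNe] : a ^+ 2 != e ^+ 2 by rewrite e2.
have /sqr_neq/andP[aw aNw] : a ^+ 2 != w ^+ 2 by rewrite w2.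
have /sqr_neq/andP[ew eNw] : e ^+ 2 != w ^+ 2 by rewrite e2 w2.
have oppC (x y : F) : (- x == y) = (x == - y) by rewrite eqr_oppLR.
exists (a |: (e |: [set w])); split.
- apply/subsetP => x; rewrite !inE => /or3P[] /eqP ->; apply/orP.
  + by left; rewrite ac.
  + by right; rewrite -[2.*2]/(2 * 2)%N exprM e2 expr1n.
  by right; rewrite -[2.*2]/(2 * 2)%N exprM w2 sqrrN expr1n.
- move=> x; rewrite !inE !oppC => /or3P[] /eqP ->; rewrite !negb_or.
  + by rewrite oppr_neq // aNe aNw.
  + by rewrite -oppC eq_sym aNe oppr_neq // eNw.
  by rewrite -!oppC ![- w == _]eq_sym aNw eNw oppr_neq.
- rewrite !big_setU1 ?inE ?negb_or ?ae ?aw ?ew //= big_set1 wE addrA.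
  exact: sum_e.
by rewrite !cardsU1 !inE negb_or ae aw ew cards1.
Qed.

(** * Assembling the code *)

(* The quadratic character of diff_prod S x does not depend on x in S, so the
   column multipliers v are square roots of the ratios of these values. *)
Lemma nmds_self_dual_exists (F : finFieldType) (h s t : nat) :
    (0 < h)%N -> #|F| = (h.*2.+1 ^ 2)%N -> h.*2.+1%:R = 0 :> F ->
    (forall x y : F, (x - y) ^+ h.*2.+1 = x ^+ h.*2.+1 - y ^+ h.*2.+1) ->
    (s <= h.+1)%N -> (0 < t <= h)%N -> odd s = odd h ->
  exists C : {vspace 'rV[F]_(s * h.*2 + t * h.+1.*2)}, NMDS C /\ self_dual C.
Proof.
move=> h0 cardF r0 frob sh /andP[t0 th] oddsh.
have kmA := card_pred_sqr cardF.
have kmB : (h.+1.*2 * h.*2)%N = #|F|.-1 by rewrite mulnC.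
have two0 : 2%:R != 0 :> F.
  apply: contra_eq_neq r0 => two0; rewrite -addn1 natrD -mul2n natrM two0.
  by rewrite mul0r add0r oner_neq0.
(* There are h + 1 elements with [c ^+ h.+1 = -1] and h elements with [d ^+ h = 1]; the upper bounds
   on [s] and [t] allow the choice of [C] and [D]. *)
have [C CP cC] : exists2 C : {set F},
    C \subset [set c | c ^+ h.+1 == -1] & #|C| = s.
  apply: subset_of_card; rewrite (@card_powers _ _ (h.*2 * 2)) //.
    by rewrite -kmA; lia.
  by rewrite mulnC exprM sqrrN !expr1n.
have [D DP cD] : exists2 D : {set F},
    D \subset [set d | d ^+ h == 1] & #|D| = t.
  apply: subset_of_card; rewrite (@card_powers _ _ (h.+1.*2 * 2)) ?expr1n //.
  by rewrite -kmA; lia.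
have hC c : c \in C -> c ^+ h.+1 = -1 by move/(subsetP CP); rewrite inE => /eqP.
have hD d : d \in D -> d ^+ h = 1 by move/(subsetP DP); rewrite inE => /eqP.
have oddC : odd #|C| = odd h by rewrite cC.
have C1 c : c \in C -> c ^+ h.+1.*2 = 1.
  by move/hC => cr; rewrite -muln2 exprM cr sqrrN expr1n.
have D1 d : d \in D -> d ^+ h.*2 = 1.
  by move/hD => dr; rewrite -muln2 exprM dr expr1n.
pose A := [set x | x ^+ h.*2 \in C]; pose B := [set x | x ^+ h.+1.*2 \in D].
pose S := A :|: B.
have charS x : x \in S -> diff_prod S x ^+ (h.*2 * h.+1) = (-1) ^+ h.
  exact: quad_char_diff_prod.
have C0 : 0 \notin C.
  by apply/negP => /C1/eqP; rewrite expr0n double_eq0 /= eq_sym oner_eq0.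
have D0 : 0 \notin D.
  by apply/negP => /hD/eqP; rewrite expr0n gtn_eqF // eq_sym oner_eq0.
have S0 : 0 \notin S.
  by rewrite !inE !expr0n !double_eq0 (gtn_eqF h0) (negPf C0) (negPf D0).
have symS x : x \in S -> - x \in S.
  have evenN m : (- x) ^+ m.*2 = x ^+ m.*2 by rewrite -mul2n !exprM sqrrN.
  by rewrite !inE !evenN.
have dAB : [disjoint A & B].
  apply/pred0P => y; rewrite /= !inE; apply/negP => /andP[/hC yC /hD yD].
  have : y ^+ (h.*2 * h.+1) = y ^+ (h.+1.*2 * h).
    by rewrite mulnC -doubleMr doubleMl.
  move/eqP; rewrite !exprM yC yD eq_sym.
  by rewrite (negPf (oppr_neq two0 (oner_neq0 _))).
have cS : #|S| = (s * h.*2 + t * h.+1.*2)%N.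
  rewrite cardsU (disjoint_setI0 dAB) cards0 subn0.
  by rewrite (card_preim_exp kmA C1) (card_preim_exp kmB D1) cC cD.
have [k ck] : exists k, #|S| = k.+1.*2.
  exists (s * h + t * h.+1).-1; rewrite cS -!doubleMr -doubleD prednK //.
  by rewrite addn_gt0 !muln_gt0 t0 orbT.
have [T [TS antiT T0 oddT]] : exists T : {set F},
    [/\ T \subset S, (forall x, x \in T -> - x \notin T),
        \sum_(x in T) x = 0 & odd #|T| = odd k.+1].
  (* If k + 1 is even, the empty [T] already has the right parity. *)
  case: (boolP (odd k.+1)) => _.
    by apply: odd_zero_sum_subset; rewrite ?cD.
  exists set0; split; rewrite ?sub0set ?big_set0 ?cards0 // => x.
  by rewrite inE.
have [K [KS cK K0]] := zero_sum_half two0 S0 symS ck TS antiT T0 oddT.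
(* The common value [l] is the one at an arbitrary reference point [x0]; outside [S] the multiplier
   gets the default 0. *)
have /card_gt0P[x0 x0S] : (0 < #|S|)%N by rewrite ck.
have [v vP] : exists v : F -> F, forall x, x \in S ->
    v x ^+ 2 * diff_prod S x = diff_prod S x0.
  apply: (@fin_all_exists _ _ (fun x y =>
    x \in S -> y ^+ 2 * diff_prod S x = diff_prod S x0)) => x.
  have km : (2 * (h.*2 * h.+1))%N = #|F|.-1.
    by rewrite -kmA -doubleMr mul2n.
  case: (boolP (x \in S)) => [xS|_]; last by exists 0.
  have [] := @power_root _ _ _ (diff_prod S x0 / diff_prod S x) km.
    by rewrite exprMn exprVn !charS // divff // expf_neq0 // oppr_eq0 oner_eq0.
  by move=> y yE; exists y => _; rewrite yE divfK // diff_prod_neq0.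
have v0 x : x \in S -> v x != 0.
  move=> xS; apply: contra_eq_neq (vP x xS) => ->.
  by rewrite expr0n mul0r eq_sym diff_prod_neq0.
rewrite -cS; apply: nmds_self_dual_code ck _ v0 vP KS cK K0.
exact: sum_symmetric.
Qed.

Local Close Scope ring_scope.

Theorem theorem3p5 (r : nat) (r_pp : prime_power r) (r_odd : odd r)
    (F : finFieldType) (cardF : #|F| = (r ^ 2)%N)
    (s t : nat)
    (s_bounds : (1 <= s <= (r + 1) %/ 2)%N)
    (t_bounds : (1 <= t <= (r - 1) %/ 2)%N)
    (n : nat) (n_def : n = (s * (r - 1) + t * (r + 1))%N)
    (rs_cond : (r = 1 %[mod 4] /\ ~~ odd s) \/ (r = 3 %[mod 4] /\ odd s)) :
  exists C : {vspace 'rV[F]_n}, NMDS C /\ self_dual C.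
Proof.
have [h rE] : exists h, r = h.*2.+1 by exists r./2; lia.
have h0 : (0 < h)%N by lia.
have nE : n = s * h.*2 + t * h.+1.*2.
  by rewrite n_def rE subn1 addn1.
case: r_pp => p [m [p_pr m0 rp]].
rewrite nE; apply: nmds_self_dual_exists => //.
- by rewrite cardF rE.
- by rewrite -rE rp natr_root_card // cardF rp.
- by move=> x y; rewrite -rE rp frobenius_sub // cardF rp.
- by lia.
- by lia.
(* As r = 2h + 1, r is 1 or 3 modulo 4 according to whether h is even or odd. *)
by lia.
Qed.
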